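(* Let $h:J\to\mathbb{R}^M$ be the vector-valued fractal interpolation function determined by the IFS $\mathcal{I}=\{J\times\mathbb{R}^M; W_k: k\in T\}$ described in the context. Suppose there are constants $0<c_k\le C_k<1$ ($k\in T$) such that for every $k\in T$ and all $(t_1,\boldsymbol{z}_1),(t_2,\boldsymbol{z}_2)\in J\times\mathbb{R}^M$, $$c_k\, d((t_1,\boldsymbol{z}_1),(t_2,\boldsymbol{z}_2))\le d(W_k(t_1,\boldsymbol{z}_1),W_k(t_2,\boldsymbol{z}_2))\le C_k\, d((t_1,\boldsymbol{z}_1),(t_2,\boldsymbol{z}_2)).$$ Then $r\le \dim_H(G(h))\le R$, where $r$ and $R$ are determined by $\sum_{k\in T}c_k^{\,r}=1$ and $\sum_{k\in T}C_k^{\,R}=1$, respectively.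
   Context: Setting: $M\ge 1$, $(x_i,\boldsymbol{y}_i)\in\mathbb{R}\times\mathbb{R}^M$ ($i=1,\dots,N$) are data points with $x_1<x_2<\dots<x_N$, $T=\{1,\dots,N-1\}$, $J=[x_1,x_N]$, $J_k=[x_k,x_{k+1}]$. For $k\in T$, $P_k(t)=a_kt+d_k$ is the affine map $J\to J_k$ with $P_k(x_1)=x_k$, $P_k(x_N)=x_{k+1}$; each $P_k$ is contractive (so $N\ge 3$). For $k\in T$, $\alpha_k\in(-1,1)$ and $q_k:J\to\mathbb{R}^M$ is continuous with $q_k(x_1)=\boldsymbol{y}_k-\alpha_k\boldsymbol{y}_1$, $q_k(x_N)=\boldsymbol{y}_{k+1}-\alpha_k\boldsymbol{y}_N$; put $F_k(t,\boldsymbol{z})=\alpha_k\boldsymbol{z}+q_k(t)$ and $W_k(t,\boldsymbol{z})=(P_k(t),F_k(t,\boldsymbol{z}))$ on $J\times\mathbb{R}^M$. The IFS $\{J\times\mathbb{R}^M;W_1,\dots,W_{N-1}\}$ has a unique attractor (nonempty compact set equal to the union of its images under the $W_k$), which is the graph of a continuous function $h:J\to\mathbb{R}^M$, the fractal interpolation function (FIF), satisfying $h(t)=\alpha_k h(P_k^{-1}(t))+q_k(P_k^{-1}(t))$ for $t\in J_k$, $k\in T$. $G(h)$ denotes the graph of $h$, $d$ is the Euclidean metric on $J\times\mathbb{R}^M\subset\mathbb{R}^{M+1}$, and $\dim_H$ is Hausdorff dimension. *)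

(* Defs.v *)
From HB Require Import structures.
From mathcomp Require Import all_boot all_order all_algebra.
From mathcomp Require Import all_classical all_reals all_analysis.
Import Order.TTheory GRing.Theory Num.Theory.
Import numFieldNormedType.Exports.

Set Implicit Arguments.
Unset Strict Implicit.
Unset Printing Implicit Defensive.

Local Open Scope classical_set_scope.
Local Open Scope ring_scope.

(** * Hausdorff measure and dimension with respect to a distance [dist] *)

(* The maximum with 0 only matters for the empty set, whose diameter is 0. *)
Definition diam {R : realType} {T : Type} (dist : T -> T -> R) (U : set T)
    : \bar R :=
  maxe 0%E (ereal_sup [set (dist p.1 p.2)%:E | p in U `*` U]).

(* [diam U ^ s], with value 0 on the empty set for every [s], including [s = 0]
   (for which the library has [0 `^ 0 = 1]): a countable cover may thus be
   padded with empty sets, and the measure of index 0 is the counting measure. *)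
Definition diam_pow {R : realType} {T : Type} (dist : T -> T -> R) (s : R)
    (U : set T) : \bar R :=
  if U == set0 then 0%E else (diam dist U `^ s)%E.

Definition delta_cover {R : realType} {T : Type} (dist : T -> T -> R)
    (delta : R) (E : set T) (U : (set T)^nat) : Prop :=
  E `<=` \bigcup_i U i /\ forall i, (diam dist (U i) <= delta%:E)%E.

Definition hausdorff_content {R : realType} {T : Type} (dist : T -> T -> R)
    (s delta : R) (E : set T) : \bar R :=
  ereal_inf [set (\sum_(0 <= i <oo) diam_pow dist s (U i))%E
            | U in delta_cover dist delta E].

(* The content is nonincreasing in [delta], so that its limit as [delta] tends
   to [0^+] is the supremum. *)
Definition hausdorff_measure {R : realType} {T : Type} (dist : T -> T -> R)
    (s : R) (E : set T) : \bar R :=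
  ereal_sup [set hausdorff_content dist s delta E
            | delta in [set delta : R | 0 < delta]].

Definition hausdorff_dim {R : realType} {T : Type} (dist : T -> T -> R)
    (E : set T) : \bar R :=
  ereal_inf [set s%:E
            | s in [set s : R | 0 <= s /\ hausdorff_measure dist s E = 0%E]].

(** * The Euclidean distance and graphs in [R * R^M] *)

(* The library norm on ['rV[R]_M] and on products is the sup norm; it induces
   the same topology as the Euclidean distance. *)
Definition euclid_dist {R : realType} {M : nat} (p p' : R * 'rV[R]_M) : R :=
  Num.sqrt ((p.1 - p'.1) ^+ 2 + \sum_(j < M) (p.2 ord0 j - p'.2 ord0 j) ^+ 2).

Definition graph_on {R : realType} {M : nat} (J : set R) (h : R -> 'rV[R]_M)
    : set (R * 'rV[R]_M) :=
  [set (t, h t) | t in J].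

(** * Iterated function systems and fractal interpolation functions *)

Definition is_attractor {X : topologicalType} {I : Type} (D : set X)
    (W : I -> X -> X) (A : set X) : Prop :=
  [/\ A `<=` D, A !=set0, compact A & A = \bigcup_k (W k @` A)].

(* The [n + 1] nodes are indexed by ['I_n.+1] and the [n] intervals between
   consecutive nodes by ['I_n]: interval [k] has end nodes [lnode k = k] and
   [rnode k = k + 1]. *)
Definition lnode {n : nat} (k : 'I_n) : 'I_n.+1 := widen_ord (leqnSn n) k.
Definition rnode {n : nat} (k : 'I_n) : 'I_n.+1 := lift ord0 k.

Definition base_interval {R : realType} {n : nat} (x : 'I_n.+1 -> R) : set R :=
  `[x ord0, x ord_max].

Definition fif_P {R : realType} {n : nat} (a d : 'I_n -> R) (k : 'I_n) (t : R)
    : R :=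
  a k * t + d k.

Definition fif_F {R : realType} {M n : nat} (alpha : 'I_n -> R)
    (q : 'I_n -> R -> 'rV[R]_M) (k : 'I_n) (p : R * 'rV[R]_M) : 'rV[R]_M :=
  alpha k *: p.2 + q k p.1.

Definition fif_W {R : realType} {M n : nat} (a d alpha : 'I_n -> R)
    (q : 'I_n -> R -> 'rV[R]_M) (k : 'I_n) (p : R * 'rV[R]_M)
    : R * 'rV[R]_M :=
  (fif_P a d k p.1, fif_F alpha q k p).

(* Standing assumptions on the data [(x_i, y_i)] and on the maps. The functions
   [q k] and [h] are only relevant on [base_interval x]. With at least three
   nodes, the end-point conditions on [fif_P] force [0 < a k < 1], that is,
   each [fif_P a d k] is contractive. *)
Record fif_data {R : realType} {M n : nat} (x : 'I_n.+1 -> R)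
    (y : 'I_n.+1 -> 'rV[R]_M) (a d alpha : 'I_n -> R)
    (q : 'I_n -> R -> 'rV[R]_M) : Prop := FifData {
  fif_x_incr : forall i j : 'I_n.+1, (i < j)%N -> x i < x j;
  fif_P_left : forall k, fif_P a d k (x ord0) = x (lnode k);
  fif_P_right : forall k, fif_P a d k (x ord_max) = x (rnode k);
  fif_alpha : forall k, -1 < alpha k < 1;
  fif_q_cont : forall k, {within base_interval x, continuous (q k)};
  fif_q_left : forall k, q k (x ord0) = y (lnode k) - alpha k *: y ord0;
  fif_q_right : forall k, q k (x ord_max) = y (rnode k) - alpha k *: y ord_max
}.

Definition is_fif {R : realType} {M n : nat} (x : 'I_n.+1 -> R)
    (a d alpha : 'I_n -> R) (q : 'I_n -> R -> 'rV[R]_M) (h : R -> 'rV[R]_M)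
    : Prop :=
  {within base_interval x, continuous h} /\
  is_attractor (base_interval x `*` [set: 'rV[R]_M]) (fif_W a d alpha q)
    (graph_on (base_interval x) h).

(* Main.v *)
Require Import Defs.
From HB Require Import structures.
From mathcomp Require Import all_boot all_order all_algebra.
From mathcomp Require Import all_classical all_reals all_analysis.
From mathcomp Require Import lra.
Import Order.TTheory GRing.Theory Num.Theory.
Import numFieldNormedType.Exports.
Local Open Scope classical_set_scope.
Local Open Scope ring_scope.

(** The two bounds have independent proofs.

    Upper bound.  The graph [G] is the union of the [W k @` G], so iterating
    [m] times covers it by the finitely many images of [G] under words of
    length [m].  If [G] has diameter at most [D], the image under the word
    [k1 ... km] has diameter at most [C k1 * ... * C km * D], and the [s]-th
    powers of these bounds add up to [(\sum_k C k `^ s) ^+ m * D `^ s].  For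
    [s > r'] the base of this geometric sequence is less than 1, so the
    Hausdorff measure of index [s] vanishes ([ifs_hausdorff_measure0],
    [ifs_hausdorff_dim_le]).

    Lower bound.  No separation condition is needed, because in fact
    [r <= 1 <= dim G].  The second inequality holds for every set whose
    projection to the first axis contains a nondegenerate interval: projections
    do not increase distances, and the Lebesgue measure of the interval is at
    most twice the sum of the diameters of any cover ([hausdorff_dim_ge1]).
    For the first one, the lower Lipschitz estimate is required on the whole
    strip [J * R^M], which contains pairs of points over the two ends of [J]
    with images at the same height; their images are at distance
    [a k * (x_N - x_1)], whence [c k <= a k] ([fif_bilip_le_slope]).  The
    slopes [a k] add up to 1, since the intervals [J_k] tile [J], so
    [\sum_k c k <= 1] and [r <= 1] ([moran_exponent_le1]). *)

(** * Diameters and Hausdorff contents *)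

Lemma dist_le_diam (R : realType) (T : Type) (dist : T -> T -> R) (U : set T)
    (p p' : T) : U p -> U p' -> ((dist p p')%:E <= diam dist U)%E.
Proof.
move=> Up Up'; rewrite /diam le_max; apply/orP; right.
by apply: ereal_sup_ubound; exists (p, p').
Qed.

Lemma diam_ge0 (R : realType) (T : Type) (dist : T -> T -> R) (U : set T) :
  (0 <= diam dist U)%E.
Proof. by rewrite /diam le_max lexx. Qed.

Lemma diam_le (R : realType) (T : Type) (dist : T -> T -> R) (U : set T)
    (rho : R) : 0 <= rho -> (forall p p', U p -> U p' -> dist p p' <= rho) ->
  (diam dist U <= rho%:E)%E.
Proof.
move=> rho0 hU; rewrite /diam ge_max lee_fin rho0 /=.
by apply: ge_ereal_sup => _ [[p p'] [Up Up']] <-; rewrite lee_fin; exact: hU.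
Qed.

Lemma diam_set0 (R : realType) (T : Type) (dist : T -> T -> R) :
  diam dist set0 = 0%E.
Proof. by apply/eqP; rewrite eq_le diam_ge0 andbT; exact: diam_le. Qed.

Lemma diam_pow_ge0 (R : realType) (T : Type) (dist : T -> T -> R) (s : R)
    (U : set T) : (0 <= diam_pow dist s U)%E.
Proof. by rewrite /diam_pow; case: ifP => // _; exact: poweR_ge0. Qed.

Lemma diam_pow_le (R : realType) (T : Type) (dist : T -> T -> R) (s : R)
    (U : set T) (rho : R) : 0 <= s -> 0 <= rho ->
  (diam dist U <= rho%:E)%E -> (diam_pow dist s U <= (rho `^ s)%:E)%E.
Proof.
move=> s0 rho0 hU; rewrite /diam_pow; case: ifP => _.
  by rewrite lee_fin powR_ge0.
rewrite -poweR_EFin; apply: gt0_ler_poweR => //.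
- by rewrite in_itv /= diam_ge0 leey.
- by rewrite in_itv /= lee_fin rho0 leey.
Qed.

Lemma hausdorff_content_ge0 (R : realType) (T : Type) (dist : T -> T -> R)
    (s delta : R) (E : set T) : (0 <= hausdorff_content dist s delta E)%E.
Proof.
apply: le_ereal_inf_tmp => _ [U _ <-].
by apply: nneseries_ge0 => i _ _; exact: diam_pow_ge0.
Qed.

(** A finite cover bounds the content: [V] lists the covering sets together with
    upper bounds of their diameters, and is padded with empty sets into an
    infinite cover. *)
Lemma hausdorff_content_seq (R : realType) (T : Type) (dist : T -> T -> R)
    (s delta : R) (E : set T) (V : seq (set T * R)) :
  0 <= s -> 0 <= delta ->
  (forall p, E p -> exists2 v, v \in V & v.1 p) ->
  (forall v, v \in V -> 0 <= v.2 <= delta) ->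
  (forall v, v \in V -> forall p p', v.1 p -> v.1 p' -> dist p p' <= v.2) ->
  (hausdorff_content dist s delta E <= (\sum_(v <- V) v.2 `^ s)%:E)%E.
Proof.
move=> s0 delta0 covV rhoV distV.
pose v0 : set T * R := (set0, 0).
pose U i := (nth v0 V i).1.
have diamU i : (i < size V)%N -> (diam dist (U i) <= (nth v0 V i).2%:E)%E.
  move=> iV; have Vi := mem_nth v0 iV.
  apply: diam_le; first by case/andP: (rhoV _ Vi).
  by move=> p p' Up Up'; exact: (distV _ Vi).
have U0 i : (size V <= i)%N -> U i = set0 by move=> Vi; rewrite /U nth_default.
apply: ge_ereal_inf.
exists (\sum_(0 <= i <oo) diam_pow dist s (U i))%E.
  exists U => //; split.
    move=> p /covV [v vV vp]; exists (index v V) => //.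
    by rewrite /U nth_index.
  move=> i; have [iV|/U0 ->] := ltnP i (size V); last first.
    by rewrite diam_set0 lee_fin.
  apply: le_trans (diamU _ iV) _; rewrite lee_fin.
  by case/andP: (rhoV _ (mem_nth v0 iV)).
rewrite (nneseries_split 0 (size V)); last by move=> i _; exact: diam_pow_ge0.
rewrite add0n [X in (_ + X <= _)%E]eseries0 ?adde0; last first.
  by move=> i /U0 Ui _; rewrite /diam_pow Ui eqxx.
rewrite (big_nth v0) -sumEFin !big_mkord; apply: lee_sum => i _.
have /andP[rho0 _] := rhoV _ (mem_nth v0 (ltn_ord i)).
exact/diam_pow_le/diamU.
Qed.

(** * Iterated function systems of contractions *)

Lemma lt_powR (R : realType) (b u v : R) : 0 < b < 1 -> u < v ->
  b `^ v < b `^ u.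
Proof.
move=> /andP[b0 b1] uv; rewrite /powR gt_eqF // ltr_expR ltr_nM2r //.
by apply: ln_lt0; rewrite b0.
Qed.

Section ifs_covers.
Context {R : realType} {T : Type} {I : finType}.
Variables (dist : T -> T -> R) (W : I -> T -> T) (C : I -> R).

(** One refinement step: [V] lists sets with upper bounds of their diameters;
    each entry is replaced by its images under all the maps [W k], with the
    bound multiplied by the Lipschitz constant [C k]. *)
Definition ifs_refine (V : seq (set T * R)) : seq (set T * R) :=
  [seq (W k @` v.1, C k * v.2) | k <- index_enum I, v <- V].

Lemma ifs_refineP V w :
  reflect (exists k, exists2 v, v \in V & w = (W k @` v.1, C k * v.2))
    (w \in ifs_refine V).
Proof.
apply: (iffP allpairsP) => [[[k v] [_ /= vV ->]]|[k [v vV ->]]].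
  by exists k, v.
by exists (k, v); rewrite mem_index_enum.
Qed.

Lemma ifs_refine_cover (E : set T) V : E `<=` \bigcup_k (W k @` E) ->
  (forall p, E p -> exists2 v, v \in V & v.1 p) ->
  forall p, E p -> exists2 v, v \in ifs_refine V & v.1 p.
Proof.
move=> EW covV p /EW [k _ [p' /covV [v vV vp'] <-]].
exists (W k @` v.1, C k * v.2); first by apply/ifs_refineP; exists k, v.
by exists p'.
Qed.

(** The Lipschitz estimate is only known on [E], so the invariant carried along
    the refinements includes that the listed sets are subsets of [E]. *)
Lemma ifs_refine_bound (E : set T) V : (forall k, 0 <= C k) ->
  (forall k, W k @` E `<=` E) ->
  (forall k p p', E p -> E p' -> dist (W k p) (W k p') <= C k * dist p p') ->
  let good v := [/\ v.1 `<=` E, 0 <= v.2 &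
    forall p p', v.1 p -> v.1 p' -> dist p p' <= v.2] in
  (forall v, v \in V -> good v) -> forall v, v \in ifs_refine V -> good v.
Proof.
move=> C0 WE lipW good goodV _ /ifs_refineP [k [v /goodV [vE v0 dv] ->]].
split => /=; [|by rewrite mulr_ge0|].
- by apply: subset_trans (WE k); exact: image_subset.
- move=> _ _ [p vp <-] [p' vp' <-].
  apply: le_trans (lipW _ _ _ (vE _ vp) (vE _ vp')) _.
  by rewrite ler_wpM2l // dv.
Qed.

Lemma ifs_refine_sum (s : R) V : (forall k, 0 <= C k) ->
  (forall v, v \in V -> 0 <= v.2) ->
  \sum_(v <- ifs_refine V) v.2 `^ s =
  (\sum_k C k `^ s) * \sum_(v <- V) v.2 `^ s.
Proof.
move=> C0 V0; rewrite big_allpairs_dep mulr_suml; apply: eq_bigr => k _.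
rewrite mulr_sumr !big_seq; apply: eq_bigr => v vV /=.
by rewrite powRM // V0.
Qed.

(** The [m]-th refinement of the trivial cover by [E] has total [s]-th power sum
    [(\sum_k C k `^ s) ^+ m * D `^ s], which tends to 0.  This also makes the
    covers arbitrarily fine, since each diameter is controlled by the sum. *)
Lemma ifs_hausdorff_measure0 (E : set T) (D s : R) :
  (forall k, 0 <= C k) -> E = \bigcup_k (W k @` E) ->
  (forall k p p', E p -> E p' -> dist (W k p) (W k p') <= C k * dist p p') ->
  0 <= D -> (forall p p', E p -> E p' -> dist p p' <= D) ->
  0 < s -> \sum_k C k `^ s < 1 -> hausdorff_measure dist s E = 0%E.
Proof.
move=> C0 EW lipW D0 boundE s0 sum_lt1.
set theta := \sum_k C k `^ s in sum_lt1.
have theta0 : 0 <= theta by apply: sumr_ge0 => k _; exact: powR_ge0.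
have WE k : W k @` E `<=` E by move=> p Wp; rewrite EW; exists k.
pose V m := iter m ifs_refine [:: (E, D)].
have covV m p : E p -> exists2 v, v \in V m & v.1 p.
  elim: m p => [|m IHm] p Ep; first by exists (E, D); rewrite ?inE.
  by apply: (ifs_refine_cover E) Ep => //; rewrite -EW.
have goodV m v : v \in V m -> [/\ v.1 `<=` E, 0 <= v.2 &
    forall p p', v.1 p -> v.1 p' -> dist p p' <= v.2].
  elim: m v => [|m IHm] v; first by rewrite inE => /eqP ->; split.
  exact: (ifs_refine_bound E).
have sumV m : \sum_(v <- V m) v.2 `^ s = theta ^+ m * D `^ s.
  elim: m => [|m IHm]; first by rewrite big_seq1 expr0 mul1r.
  rewrite ifs_refine_sum //; last by move=> v /goodV [].
  by rewrite IHm exprS mulrA.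
have cvV : theta ^+ m * D `^ s @[m --> \oo] --> 0.
  rewrite -[0](mul0r (D `^ s)); apply: cvgMl; apply: cvg_expr.
  by rewrite ger0_norm.
have smallV e : 0 < e -> exists m, theta ^+ m * D `^ s < e.
  move=> e0.
  have [m _ hm] : \forall m \near \oo, theta ^+ m * D `^ s < e.
    exact: (cvgr_lt _ cvV).
  by exists m; apply: hm => /=.
apply/eqP; rewrite eq_le; apply/andP; split; last first.
  apply: ereal_sup_ge.
  exists (hausdorff_content dist s 1 E); last exact: hausdorff_content_ge0.
  by exists 1 => //=.
apply: ge_ereal_sup => _ [delta /= delta0 <-].
apply/lee_addgt0Pr => e e0; rewrite add0e.
have [m hm] : exists m, theta ^+ m * D `^ s < Num.min e (delta `^ s).
  by apply: smallV; rewrite lt_min e0 powR_gt0.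
move: hm; rewrite lt_min => /andP[hme hmd].
apply: (@le_trans _ _ (\sum_(v <- V m) v.2 `^ s)%:E); last first.
  by rewrite lee_fin sumV ltW.
apply: hausdorff_content_seq; [exact: ltW|exact: ltW|exact: covV| |].
  move=> v vV; have [_ v0 _] := goodV _ _ vV; rewrite v0 /=.
  (* [v.2 `^ s] is a term of a sum smaller than [delta `^ s]. *)
  rewrite leNgt; apply/negP => delta_lt.
  suff : v.2 `^ s <= theta ^+ m * D `^ s.
    rewrite leNgt => /negP; apply; apply: lt_trans hmd _.
    by apply: gt0_ltr_powR => //; rewrite nnegrE // ltW.
  rewrite -sumV (perm_big _ (perm_to_rem vV)) big_cons lerDl.
  by apply: sumr_ge0 => w _; exact: powR_ge0.
by move=> v /goodV [].
Qed.

(** With at least two maps, [\sum_k C k `^ s = 1] forces [0 < s], and the sum is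
    less than 1 for every larger exponent. *)
Lemma ifs_hausdorff_dim_le (E : set T) (D s : R) :
  (1 < #|I|)%N ->
  (forall k, 0 < C k < 1) -> E = \bigcup_k (W k @` E) ->
  (forall k p p', E p -> E p' -> dist (W k p) (W k p') <= C k * dist p p') ->
  0 <= D -> (forall p p', E p -> E p' -> dist p p' <= D) ->
  \sum_k C k `^ s = 1 -> (hausdorff_dim dist E <= s%:E)%E.
Proof.
move=> cardI C01 EW lipW D0 boundE sum1.
have C0 k : 0 < C k by case/andP: (C01 k).
have C1 k : C k < 1 by case/andP: (C01 k).
have /card_gt0P [k0 _] : (0 < #|I|)%N by exact: ltnW.
have s0 : 0 < s.
  rewrite ltNge; apply/negP => s_le0.
  suff : \sum_(k : I) (1 : R) <= \sum_k C k `^ s.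
    by rewrite sum1 sumr_const; apply/negP; rewrite -ltNge ltr1n.
  apply: ler_sum => k _; rewrite -[leLHS](powRr0 (C k)).
  by apply: ger_powR => //; rewrite C0 ltW.
apply/lee_addgt0Pr => e e0.
apply: ereal_inf_lbound; exists (s + e) => //; split.
  by rewrite addr_ge0 // ltW.
apply: (ifs_hausdorff_measure0 E D) => //; first by move=> k; exact: ltW.
  by rewrite addr_gt0.
rewrite -sum1; apply: ltr_sum.
  by apply/hasP; exists k0; rewrite ?mem_index_enum.
by move=> k _; apply: lt_powR => //; rewrite ltrDl.
Qed.

End ifs_covers.

(** * Sets projecting onto an interval *)

Lemma diam_le_diam_pow (R : realType) (T : Type) (dist : T -> T -> R) (s : R)
    (U : set T) : s <= 1 -> (diam dist U <= 1)%E ->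
  (diam dist U <= diam_pow dist s U)%E.
Proof.
move=> s1 U1; rewrite /diam_pow; case: ifPn => [/eqP ->|_].
  by rewrite diam_set0.
move: U1 (diam_ge0 R T dist U); case: (diam dist U) => [rho||] //.
rewrite [(_ `^ s)%E]poweR_EFin !lee_fin => rho1; rewrite le_eqVlt.
move=> /predU1P[<-|rho0]; first exact: powR_ge0.
by apply: ger1_powR => //; rewrite rho0.
Qed.

Lemma euclid_dist_ge_fst (R : realType) (M : nat) (p p' : R * 'rV[R]_M) :
  `|p.1 - p'.1| <= euclid_dist p p'.
Proof.
rewrite -sqrtr_sqr /euclid_dist ler_sqrt.
  by rewrite lerDl; apply: sumr_ge0 => j _; exact: sqr_ge0.
by apply: addr_ge0; [|apply: sumr_ge0 => j _]; exact: sqr_ge0.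
Qed.

(** If the Hausdorff measure of index [s < 1] vanished, there would be a cover
    by sets [U i] of diameter at most 1 with the sum of the [diam (U i) `^ s],
    hence that of the [diam (U i)], less than half of [v - u]; the projections
    of these sets could not cover the interval. *)
Lemma hausdorff_dim_ge1 (R : realType) (M : nat) (u v : R)
    (E : set (R * 'rV[R]_M)) : u < v -> `[u, v] `<=` fst @` E ->
  (1 <= hausdorff_dim euclid_dist E)%E.
Proof.
move=> uv projE; apply: le_ereal_inf_tmp => _ [s [s0 hs0] <-].
rewrite lee_fin leNgt; apply/negP => s1.
have : (hausdorff_content euclid_dist s 1 E < ((v - u) / 2)%:E)%E.
  apply: (@le_lt_trans _ _ 0%E); last by rewrite lte_fin divr_gt0 ?subr_gt0.
  by rewrite -hs0; apply: ereal_sup_ubound; exists 1 => //=.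
move=> /ereal_inf_lt [_ [U [covU diamU] <-]].
apply/negP; rewrite -leNgt.
pose D i := fine (diam euclid_dist (U i)).
have DE i : (D i)%:E = diam euclid_dist (U i).
  rewrite fineK // ge0_fin_numE ?diam_ge0 //.
  exact: le_lt_trans (diamU i) (ltry _).
have D0 i : 0 <= D i by rewrite -lee_fin DE diam_ge0.
(* If [U i] is nonempty, its projection lies in the interval of radius [D i]
   centred at the first coordinate of a point of [U i], chosen by [xget]. *)
pose B i : set R :=
  if U i == set0 then set0
  else [set` `[(xget (0, 0) (U i)).1 - D i, (xget (0, 0) (U i)).1 + D i]].
have measB i : measurable (B i) by rewrite /B; case: ifP.
have lebB i : (lebesgue_measure (B i) <= 2%:E * diam_pow euclid_dist s (U i))%E.
  rewrite /B; rewrite -if_neg; case: ifPn => [/set0P Ui|_]; last first.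
    by rewrite measure0 mule_ge0 ?lee_fin ?diam_pow_ge0.
  apply: (@le_trans _ _ (2%:E * (D i)%:E)%E); last first.
    rewrite lee_wpmul2l ?lee_fin // DE; exact/diam_le_diam_pow/diamU/ltW.
  rewrite lebesgue_measure_itv /=; case: ifP => _; last first.
    by rewrite mule_ge0 ?lee_fin.
  by rewrite -EFinB -EFinM lee_fin; lra.
have covB : `[u, v] `<=` \bigcup_i B i.
  move=> _ /projE [p /covU [i _ Uip] <-]; exists i => //.
  rewrite /B; case: ifPn => [/eqP U0|_]; first by rewrite U0 in Uip.
  have Uix : U i (xget (0, 0) (U i)) by exact: xgetI Uip.
  have : `|p.1 - (xget (0, 0) (U i)).1| <= D i.
    rewrite -lee_fin DE; apply: le_trans (dist_le_diam _ _ _ _ _ _ Uip Uix).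
    by rewrite lee_fin euclid_dist_ge_fst.
  by rewrite /= in_itv /= ler_norml => /andP[? ?]; apply/andP; split; lra.
have : (lebesgue_measure `[u, v] <= \sum_(0 <= i <oo) lebesgue_measure (B i))%E.
  by apply: measure_sigma_subadditive => //; exact: measurable_itv.
rewrite lebesgue_measure_itv /= lte_fin uv -EFinB => leb.
rewrite EFinM lee_pdivrMr // muleC.
rewrite -nneseriesZl; last by move=> i _; exact: diam_pow_ge0.
apply: (le_trans leb); apply: lee_nneseries => [i _ _|i _] //.
Qed.

(** * Estimates for the fractal interpolation system *)

(** The factor of a lower Lipschitz estimate for the map
    [(t, z) |-> (a * t + d, alpha *: z + q t)], valid on the whole strip over
    [[x0, x1]], is at most the slope [a] of its first component. *)
Lemma fif_bilip_le_slope (R : realType) (M : nat) (x0 x1 : R) (a d alpha c : R)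
    (q : R -> 'rV[R]_M) : (0 < M)%N -> x0 < x1 -> 0 < a -> 0 < c ->
  (forall p p' : R * 'rV[R]_M, p.1 \in `[x0, x1] -> p'.1 \in `[x0, x1] ->
    c * euclid_dist p p' <=
    euclid_dist (a * p.1 + d, alpha *: p.2 + q p.1)
                (a * p'.1 + d, alpha *: p'.2 + q p'.1)) ->
  c <= a.
Proof.
move=> M0 x01 a0 c0 bilip.
have x0J : x0 \in `[x0, x1] by rewrite in_itv /= lexx ltW.
have x1J : x1 \in `[x0, x1] by rewrite in_itv /= lexx ltW.
(* With [alpha = 0], distinct points of a vertical line would have the same
   image. *)
have alpha0 : alpha != 0.
  apply/eqP => alpha0.
  have := bilip (x0, 0) (x0, const_mx 1) x0J x0J.
  rewrite /euclid_dist /= alpha0 !scale0r subrr expr0n add0r.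
  under [X in _ <= Num.sqrt (_ + X)]eq_bigr do rewrite subrr expr0n.
  under eq_bigr do rewrite !mxE sub0r sqrrN expr1n.
  rewrite subrr expr0n !sumr_const card_ord /= mul0rn addr0 sqrtr0.
  apply/negP; rewrite -ltNge mulr_gt0 // sqrtr_gt0.
  by rewrite ltr0n.
(* The height [z] over [x1] makes the image of [(x1, z)] level with that of
   [(x0, 0)]. *)
pose z := alpha^-1 *: (q x0 - q x1).
have := bilip (x0, 0) (x1, z) x0J x1J.
have -> : euclid_dist (a * x0 + d, alpha *: (0 : 'rV[R]_M) + q x0)
    (a * x1 + d, alpha *: z + q x1) = a * (x1 - x0).
  rewrite /euclid_dist /= scaler0 add0r /z scalerA divff // scale1r subrK.
  under eq_bigr do rewrite subrr expr0n.
  rewrite sumr_const mul0rn addr0.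
  have -> : a * x0 + d - (a * x1 + d) = - (a * (x1 - x0)) by lra.
  by rewrite sqrrN sqrtr_sqr ger0_norm // mulr_ge0 ?subr_ge0 ?ltW.
move=> le_cd; rewrite -(ler_pM2r (_ : 0 < x1 - x0)) ?subr_gt0 //.
apply: le_trans le_cd; rewrite ler_pM2l //.
apply: le_trans (euclid_dist_ge_fst _ _ _ _) => /=.
by rewrite distrC ler_norm.
Qed.

Lemma sum_node_steps (R : realType) (n : nat) (x : 'I_n.+1 -> R) :
  \sum_(k < n) (x (rnode k) - x (lnode k)) = x ord_max - x ord0.
Proof.
have -> : x ord_max = x (inord n) by congr x; apply: val_inj; rewrite /= inordK.
have -> : x ord0 = x (inord 0) by congr x; apply: val_inj; rewrite /= inordK.
rewrite -(telescope_sumr (fun i => x (inord i)) (leq0n n)) big_mkord.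
apply: eq_bigr => k _; congr (x _ - x _); apply: val_inj; rewrite /= inordK //.
  by rewrite ltnS.
by rewrite ltnS ltnW.
Qed.

(** The topology is that of the sup norm, which bounds every coordinate. *)
Lemma compact_euclid_bounded (R : realType) (M : nat)
    (E : set (R * 'rV[R]_M)) : compact E ->
  exists2 D : R, 0 <= D & forall p p', E p -> E p' -> euclid_dist p p' <= D.
Proof.
move=> /compact_bounded [B0 [_ hB]].
pose B := `|B0| + 1.
have BE p : E p -> `|p| <= B.
  move=> Ep; apply: (hB B) Ep; rewrite /B.
  by apply: le_lt_trans (ler_norm _) _; rewrite ltrDl.
have B_ge0 : 0 <= B by rewrite addr_ge0.
exists (Num.sqrt ((B *+ 2) ^+ 2 + \sum_(j < M) (B *+ 2) ^+ 2)).
  exact: sqrtr_ge0.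
have sqr_le (b b' : R) : `|b| <= B -> `|b'| <= B ->
    (b - b') ^+ 2 <= (B *+ 2) ^+ 2.
  move=> hb hb'; rewrite -[leLHS]real_normK ?num_real // ler_pXn2r ?nnegrE //.
    by apply: le_trans (ler_normB _ _) _; rewrite mulr2n lerD.
  by rewrite mulrn_wge0.
have fst_le (p : R * 'rV[R]_M) : `|p.1| <= `|p|.
  by rewrite [leRHS]/Num.norm /= le_max lexx.
have snd_le (p : R * 'rV[R]_M) j : `|p.2 ord0 j| <= `|p|.
  apply: (@le_trans _ _ `|p.2|); last first.
    by rewrite [leRHS]/Num.norm /= le_max lexx orbT.
  rewrite [leRHS]/Num.norm /= mx_normrE.
  exact: (le_bigmax _ (fun i : 'I_1 * 'I_M => `|p.2 i.1 i.2|) (ord0, j)).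
move=> p p' /BE pB /BE p'B; rewrite /euclid_dist ler_sqrt.
  apply: lerD; [|apply: ler_sum => j _]; apply: sqr_le.
  - exact: le_trans pB.
  - exact: le_trans p'B.
  - exact: le_trans pB.
  - exact: le_trans p'B.
by apply: addr_ge0; [|apply: sumr_ge0 => j _]; exact: sqr_ge0.
Qed.

Lemma moran_exponent_le1 (R : realType) (I : finType) (c : I -> R) (r : R) :
  (0 < #|I|)%N -> (forall k, 0 < c k < 1) -> \sum_k c k <= 1 ->
  \sum_k c k `^ r = 1 -> r <= 1.
Proof.
move=> /card_gt0P [k0 _] c01 sum_le1 sum1; rewrite leNgt; apply/negP => r1.
suff : \sum_k c k `^ r < \sum_k c k by rewrite sum1 ltNge sum_le1.
apply: ltr_sum; first by apply/hasP; exists k0; rewrite ?mem_index_enum.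
move=> k _; have /andP[ck0 _] := c01 k.
by rewrite -[ltRHS]powRr1 ?ltW //; exact: lt_powR.
Qed.

Theorem theorem3p7 (R : realType) (M n : nat) (hM : (1 <= M)%N) (hn : (2 <= n)%N)
    (x : 'I_n.+1 -> R) (y : 'I_n.+1 -> 'rV[R]_M)
    (a d alpha : 'I_n -> R) (q : 'I_n -> R -> 'rV[R]_M)
    (hdata : fif_data x y a d alpha q)
    (h : R -> 'rV[R]_M) (hfif : is_fif x a d alpha q h)
    (c C : 'I_n -> R)
    (hcC : forall k, 0 < c k /\ c k <= C k /\ C k < 1)
    (hbilip : forall (k : 'I_n) (p p' : R * 'rV[R]_M),
       base_interval x p.1 -> base_interval x p'.1 ->
       c k * euclid_dist p p'
         <= euclid_dist (fif_W a d alpha q k p) (fif_W a d alpha q k p') /\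
       euclid_dist (fif_W a d alpha q k p) (fif_W a d alpha q k p')
         <= C k * euclid_dist p p')
    (r r' : R)
    (hr : \sum_(k < n) c k `^ r = 1) (hr' : \sum_(k < n) C k `^ r' = 1) :
  (r%:E <= hausdorff_dim euclid_dist (graph_on (base_interval x) h))%E /\
  (hausdorff_dim euclid_dist (graph_on (base_interval x) h) <= r'%:E)%E.
Proof.
have c0 k : 0 < c k by case: (hcC k).
have C1 k : C k < 1 by case: (hcC k) => _ [].
have cC k : c k <= C k by case: (hcC k) => _ [].
have x0N : x ord0 < x ord_max.
  by apply: (fif_x_incr hdata); exact: leq_trans hn.
have L0 : 0 < x ord_max - x ord0 by rewrite subr_gt0.
have step k : a k * (x ord_max - x ord0) = x (rnode k) - x (lnode k).
  rewrite -(fif_P_left hdata) -(fif_P_right hdata) /fif_P; lra.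
have a0 k : 0 < a k.
  rewrite -(pmulr_lgt0 _ L0) step subr_gt0.
  by apply: (fif_x_incr hdata) => /=.
have sum_a : \sum_k a k = 1.
  apply: (@mulIf _ (x ord_max - x ord0)); first by rewrite gt_eqF.
  rewrite mul1r mulr_suml -[RHS]sum_node_steps.
  by apply: eq_bigr => k _; exact: step.
split.
  apply: (@le_trans _ _ 1%:E); last first.
    apply: hausdorff_dim_ge1 x0N _ => t Jt.
    by exists (t, h t) => //; exists t.
  rewrite lee_fin; apply: (@moran_exponent_le1 _ _ c) hr.
  - by rewrite card_ord ltnW.
  - by move=> k; rewrite c0 /=; exact: le_lt_trans (C1 k).
  - rewrite -sum_a; apply: ler_sum => k _.
    apply: (@fif_bilip_le_slope _ _ (x ord0) (x ord_max) (a k) (d k) (alpha k)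
      (c k) (q k)) => // p p' Jp Jp'.
    by have [] := hbilip k p p' Jp Jp'.
have [_ [GD _ cptG attrG]] := hfif.
have [D D0 boundG] := compact_euclid_bounded _ _ _ cptG.
apply: (@ifs_hausdorff_dim_le _ _ _ _ (fif_W a d alpha q) C _ D) => //.
- by rewrite card_ord.
- by move=> k; rewrite C1 (lt_le_trans (c0 k)).
- move=> k p p' /GD [Jp _] /GD [Jp' _].
  by have [] := hbilip k p p' Jp Jp'.
Qed.
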